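(* Let $(\Omega,\mathcal F,\mathbf P)$, $A$, $X$, $\theta$, $\Theta=\mathbb R_{\ge 0}^n$, $G=\mathbb R_{>0}^d$, the action of $G$ on $\mathbb Z_{\ge 0}^d\times\Theta$, the functions $R_\alpha$ and $Z$ on $\Theta$, and the $\sigma$-algebra $\mathcal O$ be as described in the context. Let $\hat\theta:\Omega\to\mathbb Z_{\ge 0}^d\times\Theta$ be the measurable function defined by $\hat\theta(\omega)=(AX(\omega),\theta(\omega))$. If $\hat\theta$ is surjective, then $$\mathcal O=\sigma\bigl(AX,\ R_\alpha(\theta),\ Z(\theta)\ ;\ \alpha\in\ker A\bigr).$$
   Context: Setting. $(\Omega,\mathcal F,\mathbf P)$ is a probability space, $A=(a_{ij})$ is a $d\times n$ integer matrix (also viewed as a linear map $\mathbb R^n\to\mathbb R^d$, with kernel $\ker A\subset\mathbb R^n$), $\Theta:=\mathbb R_{\ge 0}^n$ with Borel $\sigma$-algebra $\mathcal B(\Theta)$. The parameter is treated as a random variable: $\theta:\Omega\to\Theta$ is measurable, and $X=(X_1,\dots,X_n)^\top:\Omega\to\mathbb Z_{\ge 0}^n$ is a random vector such that, conditionally on $\theta=c$, the $X_k$ are mutually independent with $X_k\sim\mathrm{Pois}(c_k)$ ($\mathrm{Pois}(0)$ is the point mass at $0$). It is assumed that $AX$ takes values in $\mathbb Z_{\ge 0}^d$. Group action. $G:=\mathbb R_{>0}^d$ acts on $\Theta$ by $g\cdot c=\bigl(c_j\prod_{i=1}^d g_i^{a_{ij}}\bigr)_{j=1,\dots,n}$ and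 on $\mathbb Z_{\ge 0}^d\times\Theta$ by $g\cdot(b,c)=(b,g\cdot c)$; $G\cdot B:=\{g\cdot x\mid g\in G,\ x\in B\}$. The $\sigma$-algebra $\mathcal O$ is $$\mathcal O:=\bigl\{\{(AX,\theta)\in B\}\ \big|\ B\in\mathcal B(\mathbb Z_{\ge 0}^d)\times\mathcal B(\Theta),\ G\cdot B=B\bigr\},$$ where $\mathcal B(\mathbb Z_{\ge 0}^d)\times\mathcal B(\Theta)$ is the product $\sigma$-algebra. Functions. For $\alpha\in\mathbb R^n$ let $J(\alpha)=\{j\mid\alpha_j\ne0\}$ and define $R_\alpha:\Theta\to\mathbb R$ by $R_\alpha(c)=\prod_{j\in J(\alpha)}c_j^{\alpha_j}$ if $c_j\neq0$ for all $j\in J(\alpha)$, and $R_\alpha(c)=0$ if $c_j=0$ for some $j\in J(\alpha)$. Define $Z:\Theta\to\mathbb R^n$ by $Z(c)=(Z_1(c),\dots,Z_n(c))^\top$ with $Z_j(c)=1$ if $c_j>0$ and $Z_j(c)=0$ if $c_j=0$. $\sigma(\cdots)$ denotes the $\sigma$-algebra on $\Omega$ generated by the listed random variables/vectors. *)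

(* Defs.v *)
From HB Require Import structures.
From mathcomp Require Import all_boot all_order all_algebra.
From mathcomp Require Import all_classical all_reals all_analysis.

Set Implicit Arguments.
Unset Strict Implicit.
Unset Printing Implicit Defensive.

Import Order.TTheory GRing.Theory Num.Theory.
Import numFieldNormedType.Exports.

Local Open Scope classical_set_scope.
Local Open Scope ring_scope.

Notation borelType T := (g_sigma_algebraType (@open T)).

Section parameter_space.
Variables (R : realType) (n : nat).

(* R_{>=0}^n, with the subspace topology of R^n. *)
Definition Theta : Type := set_type [set c : 'cV[R]_n | forall j, 0 <= c j 0].

HB.instance Definition _ := Topological.on Theta.

Fact Theta_mem (c : 'cV[R]_n) : (forall j, 0 <= c j 0) ->
  c \in [set c : 'cV[R]_n | forall j, 0 <= c j 0].
Proof. by move=> c0; rewrite inE. Qed.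

Definition mkTheta (c : 'cV[R]_n) (c0 : forall j, 0 <= c j 0) : Theta :=
  exist _ c (Theta_mem c0).

Definition theta_coord (c : Theta) (j : 'I_n) : R := (set_val c : 'cV[R]_n) j 0.

Fact theta_coord_ge0 c j : 0 <= theta_coord c j.
Proof. by case: c => c cP; move: (set_mem cP); exact. Qed.

Fact Theta0_ge0 (j : 'I_n) : 0 <= (0 : 'cV[R]_n) j 0.
Proof. by rewrite mxE. Qed.

HB.instance Definition _ := isPointed.Build Theta (mkTheta Theta0_ge0).

Definition supp (alpha : 'cV[R]_n) : pred 'I_n :=
  [pred j | alpha j 0 != 0].

Definition Rfun (alpha : 'cV[R]_n) (c : Theta) : R :=
  if [forall j in supp alpha, theta_coord c j != 0]
  then \prod_(j in supp alpha) (theta_coord c j `^ alpha j 0)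
  else 0.

Definition Zfun (c : Theta) : 'cV[R]_n :=
  \col_j (if 0 < theta_coord c j then 1 else 0).

End parameter_space.

Section action.
Variables (R : realType) (d n : nat) (A : 'M[int]_(d, n)).

(* The group R_{>0}^d; only its underlying set enters the statement. *)
Definition G : Type := set_type [set g : 'cV[R]_d | forall i, 0 < g i 0].

Definition G_coord (g : G) (i : 'I_d) : R := (set_val g : 'cV[R]_d) i 0.

Fact G_coord_gt0 g i : 0 < G_coord g i.
Proof. by case: g => g gP; move: (set_mem gP); exact. Qed.

Definition act_vec (g : G) (c : Theta R n) : 'cV[R]_n :=
  \col_j (theta_coord c j * \prod_(i < d) (G_coord g i ^ A i j)).

Fact act_vec_ge0 g c j : 0 <= act_vec g c j 0.
Proof.
rewrite mxE mulr_ge0 ?theta_coord_ge0// prodr_ge0// => i _.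
by rewrite exprz_ge0// ltW// G_coord_gt0.
Qed.

Definition act_Theta (g : G) (c : Theta R n) : Theta R n :=
  mkTheta (act_vec_ge0 g c).

Definition act_pair (g : G) (x : 'cV[nat]_d * Theta R n) :
  'cV[nat]_d * Theta R n := (x.1, act_Theta g x.2).

Definition G_saturation (B : set ('cV[nat]_d * Theta R n)) :
    set ('cV[nat]_d * Theta R n) :=
  [set y | exists g x, B x /\ y = act_pair g x].

End action.

Definition kerR (R : realType) d n (A : 'M[int]_(d, n)) : set 'cV[R]_n :=
  [set alpha | map_mx intr A *m alpha = 0].
Arguments kerR R {d n} A.

(* The absolute value only serves to land in nat: `Amul A x` is the vector A x
   as soon as the latter has nonnegative entries. *)
Definition Amul d n (A : 'M[int]_(d, n)) (x : 'cV[nat]_n) : 'cV[nat]_d :=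
  map_mx absz (A *m map_mx Posz x).

Section observation.
Variables (R : realType) (d n : nat) (A : 'M[int]_(d, n)).
Variables (disp : measure_display) (Omega : measurableType disp).
Variables (X : Omega -> 'cV[nat]_n) (theta : Omega -> Theta R n).

(* The conditional law of X given theta = c is the product of the laws
   Pois(c_j), in the form of the defining identity of a regular conditional
   distribution, on the rectangles that determine it. The second argument of
   `poisson_prob` is a dummy; `poisson_prob 0 _` is the point mass at 0
   (whereas `poisson_pmf 0` is not its mass function). *)
Definition conditionally_poisson (P : probability Omega R) : Prop :=
  forall (C : set (borelType (Theta R n))) (K : 'I_n -> set nat),
    measurable C ->
    P [set w | C (theta w) /\ forall j, K j (X w j 0)] =
    (\int[P]_(w in theta @^-1` C)
       \prod_(j < n) poisson_prob (theta_coord (theta w) j) 0 (K j))%E.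

Definition theta_hat (w : Omega) : 'cV[nat]_d * Theta R n :=
  (Amul A (X w), theta w).

Definition O_algebra : set (set Omega) :=
  [set theta_hat @^-1` B | B in
    [set B : set (borelType 'cV[nat]_d * borelType (Theta R n)) |
       measurable B /\ G_saturation A B = B]].

Definition sigma_generated : set (set Omega) :=
  <<s preimage_set_system setT (fun w => Amul A (X w))
        (measurable : set (set (borelType 'cV[nat]_d)))
      `|` \bigcup_(alpha in kerR R A)
            preimage_set_system setT (fun w => Rfun alpha (theta w)) measurable
      `|` preimage_set_system setT (fun w => Zfun (theta w))
            (measurable : set (set (borelType 'cV[R]_n))) >>.

End observation.

(* Main.v *)
Require Import Defs.
From mathcomp Require Import all_boot all_order all_algebra.
From mathcomp Require Import all_classical all_reals all_analysis.
From mathcomp Require Import measurable_realfun.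

Import Order.TTheory GRing.Theory Num.Theory.
Import numFieldNormedType.Exports.

Local Open Scope classical_set_scope.
Local Open Scope ring_scope.

(* On the stratum of [Theta] with support [S], the logarithms of the nonzero
   coordinates turn the action of [G] into the translations of [R^S] by the
   image of [A_S^T], and the logarithms of the [R_alpha] with [alpha] in
   [ker A] supported in [S] into the linear forms killing that image. A linear
   projection of [R^S] along that image thus selects one point of each orbit
   whose coordinates are invariants [R_alpha]. The resulting [slice] is a
   measurable function of the invariants alone, and an invariant set [B]
   contains [(b, c)] if and only if it contains [(b, slice c)]; hence
   [{(AX, theta) in B} = {(AX, slice theta) in B}] lies in the generated
   sigma-algebra. The other inclusion only uses that the generators are
   invariant. *)

(** * Orbits of the action in logarithmic coordinates *)

Section orbits.
Context {R : realType} {d n : nat}.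
Implicit Types (c : Theta R n) (g : G R d) (gamma : 'cV[R]_d).
Variable A : 'M[int]_(d, n).

Lemma theta_coord_inj c c' : theta_coord c =1 theta_coord c' -> c = c'.
Proof.
move=> cc'; apply: val_inj; apply/matrixP => i j.
by rewrite ord1; exact: cc'.
Qed.

(* No case distinction is left because [0 `^ 0 = 1] discards the indices outside
   [supp alpha], and [0 `^ x = 0] for [x != 0] gives the second case of
   [Rfun]. *)
Lemma RfunE (alpha : 'cV[R]_n) c :
  Rfun alpha c = \prod_j theta_coord c j `^ alpha j 0.
Proof.
rewrite /Rfun [RHS](bigID (supp alpha))/= [X in _ * X]big1 ?mulr1; last first.
  by move=> j /negPn /eqP ->; rewrite powRr0.
case: ifPn => // /forall_inPn[j aj /negPn /eqP cj0].
by rewrite (bigD1 j)//= cj0 powR0 ?mul0r.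
Qed.

Lemma exp_col_gt0 gamma :
  (\col_i expR (gamma i 0) : 'cV[R]_d) \in
    [set g : 'cV[R]_d | forall i, 0 < g i 0].
Proof. by rewrite inE /= => i; rewrite mxE expR_gt0. Qed.

Definition Gexp gamma : G R d :=
  exist _ (\col_i expR (gamma i 0)) (exp_col_gt0 gamma).

Definition Gln g : 'cV[R]_d := \col_i ln (G_coord g i).

Definition AR : 'M[R]_(d, n) := map_mx intr A.

Lemma GexpK : cancel Gexp Gln.
Proof. by move=> gamma; apply/colP => i; rewrite mxE /G_coord/= mxE expRK. Qed.

Lemma theta_coord_act g c j :
  theta_coord (act_Theta A g c) j =
  theta_coord c j * expR ((AR^T *m Gln g) j 0).
Proof.
rewrite /theta_coord /= mxE; congr (_ * _).
rewrite mxE expR_sum; apply: eq_bigr => i _; rewrite !mxE.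
have g0 := G_coord_gt0 g i.
by rewrite -powR_intmul ?(ltW g0)// mulrC expRM lnK.
Qed.

(** [G] carries no group structure here, so inverses are taken through logarithms. *)
Lemma act_GexpK g x : act_pair A (Gexp (- Gln g)) (act_pair A g x) = x.
Proof.
case: x => b c; congr pair; apply: theta_coord_inj => j /=.
rewrite !theta_coord_act GexpK mulmxN [fun_of_matrix (- _) _ _]mxE.
by rewrite -mulrA -expRD subrr expR0 mulr1.
Qed.

Lemma G_saturationP (B : set ('cV[nat]_d * Theta R n)) :
  G_saturation A B = B <-> forall g x, B (act_pair A g x) <-> B x.
Proof.
split=> [BE g x | Bact].
  split=> Bx; rewrite -BE; last by exists g, x.
  by exists (Gexp (- Gln g)), (act_pair A g x); rewrite act_GexpK.
apply/seteqP; split=> [_ [g [x [Bx ->]]] | x Bx]; first exact/Bact.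
(* Translating [x] and translating back exhibits it as a translate; any element of [G] would do in
   place of [Gexp 0]. *)
exists (Gexp (- Gln (Gexp 0))), (act_pair A (Gexp 0) x).
by rewrite act_GexpK; split=> //; apply/Bact.
Qed.

(** The action multiplies [Rfun alpha] by the exponential of the pairing of A^T ln g with alpha,
    which equals that of ln g with A alpha = 0. *)
Lemma Rfun_act (alpha : 'cV[R]_n) g c : kerR R A alpha ->
  Rfun alpha (act_Theta A g c) = Rfun alpha c.
Proof.
move=> Aalpha; rewrite !RfunE.
under eq_bigr => j _ do
  rewrite theta_coord_act powRM ?theta_coord_ge0 ?expR_ge0// -expRM.
rewrite big_split/= -expR_sum [X in expR X](_ : _ = 0) ?expR0 ?mulr1//.
transitivity (((Gln g)^T *m (AR *m alpha)) 0 0); last first.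
  by rewrite (_ : AR *m alpha = 0) ?mulmx0 ?mxE.
rewrite mulmxA [RHS]mxE; apply: eq_bigr => j _; congr (_ * _).
by rewrite -[AR in RHS]trmxK -trmx_mul [RHS]mxE.
Qed.

Lemma Zfun_act g c : Zfun (act_Theta A g c) = Zfun c.
Proof.
by apply/colP => j; rewrite !mxE theta_coord_act pmulr_lgt0 ?expR_gt0.
Qed.

Definition pos c : {set 'I_n} := [set j | 0 < theta_coord c j]%SET.

Definition ind (S : {set 'I_n}) : 'cV[R]_n := \col_j (j \in S)%:R.

Lemma Zfun_ind c : Zfun c = ind (pos c).
Proof. by apply/colP => j; rewrite !mxE inE; case: ifP. Qed.

Lemma ind_inj : injective ind.
Proof.
move=> S S' /colP SS'; apply/setP => j; have := SS' j; rewrite !mxE.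
by case: (_ \in S); case: (_ \in S') => // /eqP;
  rewrite ?oner_eq0// eq_sym oner_eq0.
Qed.

Section support.
Variable S : {set 'I_n}.

Let D : 'M[R]_n := diag_mx (ind S)^T.
Let W : 'M[R]_(n, d) := D *m AR^T.

(* As [W *m pinvmx W *m W = W], this is a projection of [R^S] along the image of
   [A_S^T], and its rows lie in [ker A]. *)
Definition slice_mx : 'M[R]_n := D - W *m pinvmx W *m D.

Definition slice_exponent (j : 'I_n) : 'cV[R]_n := (row j slice_mx)^T.

Lemma slice_exponent_ker j : kerR R A (slice_exponent j).
Proof.
rewrite /kerR /= -/AR /slice_exponent -[AR]trmxK -trmx_mul -row_mul.
rewrite /slice_mx mulmxBl -[X in _ - X]mulmxA -/W mulmxKpV ?submx_refl// subrr.
by rewrite row0 trmx0.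
Qed.

(** The right factor [D] of [slice_mx] kills the columns outside [S]. *)
Lemma slice_exponent_supp j k : k \notin S -> slice_exponent j k 0 = 0.
Proof.
move=> kS; rewrite 2!mxE /slice_mx -[X in X - _]mul1mx -mulmxBl mul_mx_diag.
by rewrite mxE 2![X in _ * X]mxE (negbTE kS) mulr0.
Qed.

(** For [j] outside [S] the exponent is 0 and [Rfun] takes the value 1 there; the indicator brings
    the coordinate back to 0. *)
Definition slice_vec c : 'cV[R]_n :=
  \col_j ((j \in S)%:R * Rfun (slice_exponent j) c).

Fact slice_vec_ge0 c j : 0 <= slice_vec c j 0.
Proof.
by rewrite mxE mulr_ge0// RfunE; apply: prodr_ge0 => k _; exact: powR_ge0.
Qed.

Definition slice c : Theta R n := mkTheta (slice_vec_ge0 c).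

End support.

(** On the support, the slice has logarithms [y - AR^T *m (pinvmx W *m (D *m y))]: a translate of
    the logarithms [y] of [c], from which the group element is read off. *)
Lemma slice_orbit c : exists g, slice (pos c) c = act_Theta A g c.
Proof.
pose S := pos c; pose D : 'M[R]_n := diag_mx (ind S)^T.
pose W : 'M[R]_(n, d) := D *m AR^T.
(* Off the support [ln] takes a default value, which [D] erases. *)
pose y : 'cV[R]_n := \col_j ln (theta_coord c j).
exists (Gexp (- (pinvmx W *m (D *m y)))); apply: theta_coord_inj => j.
rewrite theta_coord_act GexpK /theta_coord/= mxE -/(theta_coord c j).
have [jS|] := boolP (j \in pos c); last first.
  rewrite inE -leNgt => cj; rewrite mul0r.
  rewrite (_ : theta_coord c j = 0) ?mul0r//.
  by apply/eqP; rewrite eq_le cj theta_coord_ge0.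
have cj0 : 0 < theta_coord c j by move: jS; rewrite inE.
have DE (v : 'cV[R]_n) : (D *m v) j 0 = v j 0 :> R.
  by rewrite mul_diag_mx mxE 2!mxE jS mul1r.
rewrite mul1r RfunE.
transitivity (expR ((slice_mx S *m y) j 0)).
  rewrite mxE expR_sum; apply: eq_bigr => k _.
  rewrite (_ : slice_exponent S j k 0 = slice_mx S j k);
    last by rewrite 2!mxE.
  have [kS|kS] := boolP (k \in S).
    move: kS; rewrite inE => ck0.
    by rewrite [y k 0]mxE mulrC expRM lnK.
  (* Coordinate [k] is zero here, but so is its exponent, so the factor is 1. *)
  have := slice_exponent_supp S j k kS; rewrite 2!mxE => ->.
  by rewrite powRr0 mul0r expR0.
rewrite -[theta_coord c j]lnK ?posrE// -expRD; congr expR.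
rewrite mulmxBl mxE DE [y j 0]mxE; congr (_ + _).
by rewrite mxE mulmxN [RHS]mxE -[in RHS]DE !mulmxA.
Qed.

End orbits.

(** * Borel measurability in R^n and [Theta], coordinate by coordinate *)

Section borel.
Context {R : realType}.

Lemma continuous_borel_measurable (T : ptopologicalType) (f : T -> R) :
  continuous f -> measurable_fun setT (f : borelType T -> R).
Proof.
move=> /continuousP cf; apply: (measurability _ (RGenOpens.measurableE R)).
move=> _ [_ [x [y ->]] <-]; rewrite setTI; apply: sub_sigma_algebra.
exact/cf/interval_open.
Qed.

Definition rat_box n (i : 'cV[rat]_n * rat) : set 'cV[R]_n :=
  [set x | forall j, ball (ratr (i.1 j 0) : R) (ratr i.2) (x j 0)].

(** A box containing [x] with radius below [e / 2] stays in the sup-norm ball of radius [e] around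
    [x], by the triangle inequality through its centre. *)
Lemma open_rat_boxes n (U : set 'cV[R]_n) : open U ->
  U = \bigcup_(i in [set i | rat_box n i `<=` U]) rat_box n i.
Proof.
move=> oU; apply/seteqP; split=> [x Ux | x [i iU]]; last exact: iU.
have /nbhs_ballP[e /= e0 xeU] : nbhs x U by exact: open_nbhs_nbhs.
have e20 : 0 < e / 2 by rewrite divr_gt0.
have [r] := rat_in_itvoo e20; rewrite in_itv/= => /andP[r0 re].
have /choice[q qx] j : exists q : rat, ball (ratr q : R) (ratr r) (x j 0).
  have /rat_in_itvoo[q] : x j 0 - ratr r < x j 0 + ratr r.
    by rewrite ltrD2l gtrN.
  by rewrite in_itv/= -ltr_distlC distrC => qx; exists q.
exists (\col_j q j, r) => [y /= yq|j /=]; last by rewrite mxE.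
apply: xeU; split=> // i j; rewrite ord1.
have := yq i; rewrite mxE => qy; apply: (@ball_splitr _ _ (ratr (q i) : R)).
  exact: le_ball (ltW re) _ (qx i).
exact: le_ball (ltW re) _ qy.
Qed.

(** An open set is a countable union of rational boxes, and the preimage of a box is a finite
    intersection of preimages under coordinates. *)
Lemma measurable_fun_col disp (T : measurableType disp) n (f : T -> 'cV[R]_n) :
  (forall j, measurable_fun setT (fun t => f t j 0)) ->
  measurable_fun setT (f : T -> borelType 'cV[R]_n).
Proof.
move=> mf; apply: (@measurability _ _ _ (borelType 'cV[R]_n) _ _ open erefl).
move=> _ [U oU <-]; rewrite setTI (open_rat_boxes n U oU) preimage_bigcup.
rewrite bigcup_mkcond; apply: countable_bigcupT_measurable => // i.
case: ifPn => // _.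
rewrite (_ : _ @^-1` _ =
    \bigcap_(j in setT)
      ((fun t => f t j 0) @^-1` ball (ratr (i.1 j 0) : R) (ratr i.2))).
  apply: fin_bigcap_measurable => [|j _]; first exact: finite_finset.
  rewrite -[X in measurable X]setTI; apply: mf => //; exact: measurable_ball.
by apply/seteqP; split=> t /= h j => [_|]; exact: h.
Qed.

Lemma measurable_fun_Theta disp (T : measurableType disp) n
    (f : T -> Theta R n) :
  (forall j, measurable_fun setT (fun t => theta_coord (f t) j)) ->
  measurable_fun setT (f : T -> borelType (Theta R n)).
Proof.
move=> mf; apply: (@measurability _ _ _ (borelType (Theta R n)) _ _ open erefl).
(* Open sets of [Theta] are traces of open sets [U] of R^n. *)
move=> _ [_ [U oU <-] <-]; rewrite -comp_preimage.
apply: (measurable_fun_col _ _ _ (set_val \o f)) => //; exact: sub_sigma_algebra.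
Qed.

Lemma measurable_theta_coord n j :
  measurable_fun setT (fun c : borelType (Theta R n) => theta_coord c j).
Proof.
apply: continuous_borel_measurable => c.
apply: (@continuous_comp _ _ _ _ (fun M : 'cV[R]_n => M j 0)).
  exact: initial_continuous.
exact: coord_continuous.
Qed.

Lemma measurable_Rfun n (alpha : 'cV[R]_n) :
  measurable_fun setT (Rfun alpha : borelType (Theta R n) -> R).
Proof.
rewrite (_ : Rfun alpha = fun c => \prod_j theta_coord c j `^ alpha j 0);
  last by apply/funext => c; rewrite RfunE.
apply: measurable_prod => j _.
apply: (@measurableT_comp _ _ _ _ _ _ (@powR R ^~ (alpha j 0)) _
  (fun c : borelType (Theta R n) => theta_coord c j)).
  exact: measurable_powR.
exact: measurable_theta_coord.
Qed.

Lemma measurable_Zfun n :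
  measurable_fun setT (@Zfun R n : borelType (Theta R n) -> borelType 'cV[R]_n).
Proof.
apply: measurable_fun_col => j; under eq_fun do rewrite mxE.
apply: measurable_fun_ifT => //.
apply: measurable_fun_ltr => //; exact: measurable_theta_coord.
Qed.

Lemma borel_set1 n (x : 'cV[R]_n) :
  measurable ([set x] : set (borelType 'cV[R]_n)).
Proof.
rewrite -[X in measurable X]setCK; apply: measurableC; apply: sub_sigma_algebra.
rewrite openC; apply: accessible_closed_set1; apply: hausdorff_accessible.
exact: norm_hausdorff.
Qed.

End borel.

(** Gluing along a finite measurable partition, meant for [slice], whose formula changes with the
    support. *)
Lemma measurable_fun_fibers {disp disp'} {T : measurableType disp}
    {T' : measurableType disp'} (I : finType) (h : T -> I) (f : I -> T -> T') :
  (forall i, measurable (h @^-1` [set i])) ->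
  (forall i, measurable_fun setT (f i)) ->
  measurable_fun setT (fun t => f (h t) t).
Proof.
move=> mh mf _ Y mY; rewrite setTI.
rewrite (_ : _ @^-1` Y = \bigcup_(i in setT) (h @^-1` [set i] `&` f i @^-1` Y)).
  apply: fin_bigcup_measurable => [|i _]; first exact: finite_finset.
  by apply: measurableI => //; rewrite -[X in measurable X]setTI; exact: mf.
apply/seteqP; split=> [t /= Yt | t [i _ [/= <-]]//].
by exists (h t).
Qed.

(** * The two inclusions of sigma-algebras *)

Section inclusions.
Context {R : realType} {d n : nat} (A : 'M[int]_(d, n)).
Context {disp : measure_display} {Omega : measurableType disp}.
Variables (X : Omega -> 'cV[nat]_n) (theta : Omega -> Theta R n).

Let pairT : Type := (borelType 'cV[nat]_d * borelType (Theta R n))%type.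

Lemma O_algebra_sigma_algebra : sigma_algebra setT (O_algebra A X theta).
Proof.
split=> [|E [B [mB /G_saturationP GB] <-]|E OE].
- exists set0; last exact: preimage_set0.
  split; first exact: measurable0.
  by apply/G_saturationP => g x; split.
- exists (~` B); last by rewrite setTD preimage_setC.
  split; first exact: measurableC.
  by apply/G_saturationP => g x; split=> nB Bx; apply: nB; exact/(GB g).
- have /choice[B BE] k : exists B : set pairT,
      [/\ measurable B, G_saturation A B = B &
          theta_hat A X theta @^-1` B = E k].
    by have [B [mB GB] <-] := OE k; exists B.
  exists (\bigcup_k B k); last first.
    by rewrite preimage_bigcup; apply: eq_bigcupr => k _; have [] := BE k.
  split; first by apply: bigcupT_measurable => k; have [] := BE k.
  have GB k : forall g x, B k (act_pair A g x) <-> B k x.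
    by apply/G_saturationP; have [] := BE k.
  apply/G_saturationP => g x.
  by split=> -[k _ Bk]; exists k => //; exact/(GB k g x).
Qed.

Lemma O_algebra_preimage disp' (T : measurableType disp') (f : Theta R n -> T)
    (C : set T) :
  measurable_fun setT (f : borelType (Theta R n) -> T) ->
  (forall g c, f (act_Theta A g c) = f c) -> measurable C ->
  O_algebra A X theta (setT `&` (fun w => f (theta w)) @^-1` C).
Proof.
move=> mf fact mC; exists ((f \o snd) @^-1` C : set pairT); last by rewrite setTI.
split; last by apply/G_saturationP => g [b c]; rewrite /= fact.
rewrite -[X in measurable X]setTI.
exact: (measurableT_comp mf
  (@measurable_snd _ _ (borelType 'cV[nat]_d) _) measurableT mC).
Qed.

Lemma sigma_generated_sub : sigma_generated A X theta `<=` O_algebra A X theta.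
Proof.
apply: smallest_sub; first exact: O_algebra_sigma_algebra.
move=> E [[[C mC <-]|[alpha Aalpha [C mC <-]]]|[C mC <-]].
- exists (fst @^-1` C : set pairT); last by rewrite setTI.
  split; last exact/G_saturationP.
  rewrite -[X in measurable X]setTI.
  exact: (@measurable_fst _ _ (borelType 'cV[nat]_d) _ measurableT _ mC).
- apply: (O_algebra_preimage _ R (Rfun alpha)) => //; first exact: measurable_Rfun.
  by move=> g c; exact: Rfun_act.
- apply: (O_algebra_preimage _ (borelType 'cV[R]_n) (@Zfun R n)) => //.
    exact: measurable_Zfun.
  by move=> g c; exact: Zfun_act.
Qed.

(** [Omega] with the generated sigma-algebra instead of its own, so that membership becomes
    measurability. *)
Let sigmaT := g_sigma_algebraType (sigma_generated A X theta).

Let measurable_sigmaT (E : set Omega) :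
  sigma_generated A X theta E -> measurable (E : set sigmaT).
Proof. exact: sub_sigma_algebra. Qed.

Let measurable_slice :
  measurable_fun setT (fun w : sigmaT =>
    slice A (pos (theta w)) (theta w) : borelType (Theta R n)).
Proof.
apply: (@measurable_fun_fibers _ _ sigmaT (borelType (Theta R n)) _
  (fun w => pos (theta w)) (fun S w => slice A S (theta w))).
  (* The support is read off from Z: each fiber of [pos] is the preimage of one point. *)
  move=> S; apply: measurable_sigmaT; apply: sub_sigma_algebra; right.
  exists [set ind S]; first exact: borel_set1.
  rewrite setTI; apply/seteqP; split=> w /=; rewrite Zfun_ind;
    first exact: ind_inj.
  by move=> ->.
(* For fixed [S], each coordinate is a constant times a generator [Rfun alpha]. *)
move=> S; apply: measurable_fun_Theta => j.
under eq_fun do rewrite /theta_coord/= mxE.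
apply: measurable_funM => // _ C mC; apply: measurable_sigmaT.
apply: sub_sigma_algebra; left; right; exists (slice_exponent A S j).
  exact: slice_exponent_ker.
by exists C.
Qed.

Lemma O_algebra_sub : O_algebra A X theta `<=` sigma_generated A X theta.
Proof.
move=> _ [B [mB /G_saturationP GB] <-].
suff : measurable (theta_hat A X theta @^-1` B : set sigmaT).
  by rewrite /measurable/= sigma_algebra_id//; exact: smallest_sigma_algebra.
have mAX : measurable_fun setT
    (fun w : sigmaT => Amul A (X w) : borelType 'cV[nat]_d).
  move=> _ C mC; apply: measurable_sigmaT; apply: sub_sigma_algebra; left; left.
  by exists C.
have := measurable_fun_pair mAX measurable_slice measurableT mB.
(* The slice lies in the orbit of [theta w], so the invariant set [B] does not distinguish them. *)
rewrite setTI; congr measurable; apply/seteqP; split=> w /=.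
all: have [g ->] := slice_orbit A (theta w).
all: by move=> Bw; exact/(GB g (_, theta w)).
Qed.

End inclusions.

Theorem theorem4 (R : realType) (d n : nat) (A : 'M[int]_(d, n))
    (disp : measure_display) (Omega : measurableType disp)
    (P : probability Omega R)
    (X : Omega -> 'cV[nat]_n) (theta : Omega -> Theta R n)
    (mX : measurable_fun setT (X : Omega -> borelType 'cV[nat]_n))
    (mtheta : measurable_fun setT (theta : Omega -> borelType (Theta R n)))
    (Xpoisson : conditionally_poisson X theta P)
    (AX_ge0 : forall w i, 0 <= (A *m map_mx Posz (X w)) i 0)
    (theta_hat_surj : forall y, exists w, theta_hat A X theta w = y) :
  O_algebra A X theta = sigma_generated A X theta.
Proof.
by apply/seteqP; split; [exact: O_algebra_sub | exact: sigma_generated_sub].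
Qed.
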